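(* There exists a collection $\{\Lambda_n\}_{n\in\mathbb{Z}}$ of admissible subsets of $\mathbb{R}$ such that $\Lambda_{n+1}\subset\Lambda_n$ for all $n\in\mathbb{Z}$, and $\Lambda_n$ is type 1 if $n$ is odd and type 2 if $n$ is even.
   Context: A set $\Lambda\subset\mathbb{R}$ is called admissible if it is countably infinite, unbounded, bounded from below, and has no finite accumulation points. Let $\mu$ denote Lebesgue measure on $\mathbb{R}$. For an admissible $\Lambda$ and a (Lebesgue) measurable $f:\mathbb{R}\to[0,+\infty)$, put $s(x)=\sum_{\lambda\in\Lambda}f(x+\lambda)$, $C(f,\Lambda)=\{x\in\mathbb{R}: s(x)<\infty\}$ and $D(f,\Lambda)=\{x\in\mathbb{R}: s(x)=\infty\}$. The set $\Lambda$ is type 1 if for every measurable $f:\mathbb{R}\to[0,+\infty)$ either $\mu(D(f,\Lambda))=0$ or $\mu(C(f,\Lambda))=0$. Otherwise $\Lambda$ is type 2. *)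

(* Defs.v *)
From HB Require Import structures.
From mathcomp Require Import all_boot all_order all_algebra.
From mathcomp Require Import all_classical all_reals all_analysis.

Set Implicit Arguments.
Unset Strict Implicit.
Unset Printing Implicit Defensive.

Import Order.TTheory GRing.Theory Num.Theory.
Import numFieldNormedType.Exports.

Local Open Scope classical_set_scope.
Local Open Scope ring_scope.

Definition admissible (R : realType) (L : set R) : Prop :=
  [/\ countable L, infinite_set L, ~ bounded_set (L : set R^o),
      has_lbound L & limit_point L = set0].

(* The real line with its Lebesgue sigma-algebra: the Caratheodory sets of the
   outer measure induced by interval length. The library's canonical
   sigma-algebra on R is only the Borel one. This is the type on which
   completed_lebesgue_measure is defined; it is convertible to R. *)
Definition lebesgueR (R : realType) :=
  caratheodory_type ((wlength (@idfun R))^*)%mu.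

Definition lebesgue_measurable_fun (R : realType) (f : R -> R) : Prop :=
  measurable_fun (setT : set (lebesgueR R)) (f : lebesgueR R -> measurableTypeR R).

Definition translate_sum (R : realType) (f : R -> R) (L : set R) (x : R) : \bar R :=
  \esum_(l in L) (f (x + l))%:E.

Definition conv_set (R : realType) (f : R -> R) (L : set R) : set R :=
  [set x | (translate_sum f L x < +oo)%E].

Definition div_set (R : realType) (f : R -> R) (L : set R) : set R :=
  [set x | translate_sum f L x = +oo%E].

Definition type1 (R : realType) (L : set R) : Prop :=
  forall f : R -> R, (forall x, 0 <= f x) -> lebesgue_measurable_fun f ->
    completed_lebesgue_measure (div_set f L) = 0%E \/
    completed_lebesgue_measure (conv_set f L) = 0%E.

Definition type2 (R : realType) (L : set R) : Prop := ~ type1 L.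

(* Main.v *)
From HB Require Import structures.
Require Import Defs.
From mathcomp Require Import all_boot all_order all_algebra.
From mathcomp Require Import all_classical all_reals all_analysis measurable_realfun.
From mathcomp Require Import ring lra zify.

Set Implicit Arguments.
Unset Strict Implicit.
Unset Printing Implicit Defensive.

Import Order.TTheory GRing.Theory Num.Theory.
Import numFieldNormedType.Exports.

Local Open Scope classical_set_scope.
Local Open Scope ring_scope.

(** Every set of the chain is a mesh. For m : nat -> nat, [mesh m] consists of
the points of the grid of step 2^-(m k) in [k, k + 1), for all k. A larger m
gives a larger mesh, and the type of a mesh is decided by the jumps
m (k + 1) - m k.

Unbounded jumps give type 2 ([mesh_type2]). Let f be the indicator function of
a union of short intervals, one at each integer n where m jumps a lot, as long
as the step of the mesh to the right of n. For x slightly below 0 the points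
x + lambda close to n come from the fine grid to the right of n, so that every
interval is hit and the sum is infinite. For x in [1/2, 1) they come from the
coarse grid to the left of n, and the set of the x that hit the interval at n
has measure at most 2^-jump. Jumps that grow fast enough leave a set of
positive measure on which the sum is 0.

Bounded jumps give type 1 ([mesh_type1]). A Lebesgue measurable f may be
replaced by a Borel one. Let [wrap f j] be the restriction of f to [j, j + 1),
repeated with period 1, and let T_a(x) be the sum over k of the sums of
wrap f (a + k) over the cosets x + 2^-(m k) Z modulo 1 ([wrap_sum]). For x in
[a, a + 1) the sum s(x) is at most T_a(x) + T_(a+1)(x), while T_(a+1)(x) is at
most 2 s(x). The k-th term of T_a has period 2^-(m k), hence the set where T_a
is finite is invariant under all dyadic translations, and by the density
theorem it is null or of null complement ([dyadic_zero_one]). It remains to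
carry finiteness from one integer a to all the others. From a to a + 1 it is
immediate, since T_(a+1) sums the same functions over coarser cosets. From
a + 1 to a the cosets become finer by a bounded index, and a bounded number of
halvings of the step suffices. One halving is [ae_cvg_half_shift]: if F k >= 0
has period 2^-(s k) and the sum of the F k is finite almost everywhere, then
so is the sum of the F k (x + 2^-(s k + 1)).

The last fact rests on a maximal inequality ([dyadic_maximal_all]). Let E be
the set where the sum of the F k exceeds n; its measure in a period is small
when n is large. The averages of the indicator of E over the cosets of 2^-l Z
form a reverse martingale in l, so they are all smaller than 1/4 outside a set
X that is at most 4 times as large as E. If x is not in X, then at least half
of the coset of x + 2^-(s k + 1) modulo 2^-(s k) lies outside E, for every k;
as F k is constant on that coset, the integral of F k (x + 2^-(s k + 1))
outside X is at most twice the integral of F k outside E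
([circle_integral_half_shift]). Summation over k gives at most 2 n, hence the
shifted sum is finite almost everywhere outside X, and n is arbitrary.

The resolution of the n-th set is floor (2^-n r(k)), where r(k) = k + 1 for
odd n and r(k) is the largest power of 2 below k + 2 for even n. The two
choices of r differ by a factor less than 2, so the resolution decreases
with n; the jumps are bounded in the first case and not in the second. *)

(** * Translations and periodic functions *)

Section periodic.
Context {R : realType}.
Local Notation mu := (@lebesgue_measure R).
Implicit Types (g : R -> \bar R) (t u x : R).

Lemma measurable_shift t :
  measurable_fun setT ((fun x => x + t) : R -> R).
Proof. by apply: measurable_funD. Qed.

Lemma lebesgue_measure_shift t (A : set R) : measurable A ->
  pushforward mu ((fun x => x + t) : R -> measurableTypeR R) A = mu A.
Proof.
move=> mA; apply/esym.
have mt : measurable_fun (setT : set (measurableTypeR R))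
    ((fun x => x + t) : measurableTypeR R -> measurableTypeR R).
  exact: measurable_shift.
pose phi : {mfun measurableTypeR R >-> measurableTypeR R} :=
  HB.pack ((fun x => x + t) : measurableTypeR R -> measurableTypeR R)
    (isMeasurableFun.Build _ _ _ _ _ mt).
apply: (@lebesgue_measure_unique R (pushforward mu phi)) => //= _ [[a b]] _ <-.
rewrite /pushforward.
have -> : phi @^-1` `]a, b]%classic = `]a - t, b - t]%classic.
  by apply/seteqP; split => y /=; rewrite !in_itv/= ltrBlDr lerBrDr.
by rewrite !lebesgue_measure_itv/= !lte_fin ltrD2r -!EFinB opprB addrA subrK.
Qed.

Lemma ge0_integral_shift t (D : set R) g : measurable D ->
  measurable_fun setT g -> (forall x, (0 <= g x)%E) ->
  (\int[mu]_(x in D) g x =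
   \int[mu]_(x in [set x | D (x + t)%R]) g (x + t)%R)%E.
Proof.
move=> mD mg g0.
have mt : measurable_fun (setT : set (measurableTypeR R))
    ((fun x => x + t) : measurableTypeR R -> measurableTypeR R).
  exact: measurable_shift.
pose phi : {mfun measurableTypeR R >-> measurableTypeR R} :=
  HB.pack ((fun x => x + t) : measurableTypeR R -> measurableTypeR R)
    (isMeasurableFun.Build _ _ _ _ _ mt).
rewrite -[RHS](@ge0_integral_pushforward _ _ _ _ _ phi _ mu D g)//.
- by apply: eq_measure_integral => //= A mA AS; exact/esym/lebesgue_measure_shift.
- exact: measurable_funTS.
Qed.

Lemma ge0_integral_itv_cat (a b c : R) g : a <= b -> b <= c ->
  measurable_fun setT g -> (forall x, (0 <= g x)%E) ->
  (\int[mu]_(x in `[a, c[) g x =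
   \int[mu]_(x in `[a, b[) g x + \int[mu]_(x in `[b, c[) g x)%E.
Proof.
move=> ab bc mg g0.
rewrite -ge0_integral_setU//.
- by rewrite -itv_bndbnd_setU// bnd_simp.
- exact: measurable_funTS.
- rewrite disj_set2E; apply/eqP/seteqP; split => // x [] /=; rewrite !in_itv/=.
  by move=> /andP[_ xb] /andP[bx _]; move: (lt_le_trans xb bx); rewrite ltxx.
Qed.

Lemma ge0_integral_itv_shift (a b t : R) g :
  measurable_fun setT g -> (forall x, (0 <= g x)%E) ->
  (\int[mu]_(x in `[(a + t)%R, (b + t)%R[) g x = \int[mu]_(x in `[a, b[) g (x + t)%R)%E.
Proof.
move=> mg g0; rewrite (ge0_integral_shift t)//; congr (integral _ _ _).
by apply/seteqP; split => x /=; rewrite !in_itv/= lerD2r ltrD2r.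
Qed.

Lemma periodic_int (T : Type) (h : R -> T) : (forall x, h (x + 1) = h x) ->
  forall (n : int) x, h (x + n%:~R) = h x.
Proof.
move=> h1; have hn (n : nat) x : h (x + n%:R) = h x.
  elim: n x => [|n IH] x; first by rewrite addr0.
  by rewrite -natr1 addrA h1 IH.
case=> n x; first by rewrite -pmulrn hn.
by rewrite NegzE mulrNz -(hn n.+1 (x - _)) -pmulrn subrK.
Qed.

Lemma integral_period1 u g : (forall x, g (x + 1) = g x) ->
  measurable_fun setT g -> (forall x, (0 <= g x)%E) ->
  (\int[mu]_(x in `[u, (u + 1)%R[) g x = \int[mu]_(x in `[0%R, 1%R[) g x)%E.
Proof.
move=> g1 mg g0.
pose n := Num.floor u; pose r := u - n%:~R.
have r0 : 0 <= r by rewrite subr_ge0 floor_le.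
have r1 : r < 1 by rewrite ltrBlDl -intrD1 floorD1_gt.
have -> : `[u, u + 1[%classic = `[r + n%:~R, r + 1 + n%:~R[%classic.
  by rewrite /r subrK addrAC subrK.
rewrite ge0_integral_itv_shift//.
under eq_integral do rewrite periodic_int//.
rewrite (@ge0_integral_itv_cat _ 1)//; [|exact: ltW|by rewrite lerDr].
rewrite (@ge0_integral_itv_cat 0 r 1)//; [|exact: ltW].
rewrite addeC; congr (_ + _)%E.
have -> : `[1, r + 1[%classic = `[0 + 1, r + 1[%classic by rewrite add0r.
by rewrite ge0_integral_itv_shift//; under eq_integral do rewrite g1.
Qed.

Lemma circle_integral_shift t g : (forall x, g (x + 1) = g x) ->
  measurable_fun setT g -> (forall x, (0 <= g x)%E) ->
  (\int[mu]_(x in `[0%R, 1%R[) g (x + t)%R = \int[mu]_(x in `[0%R, 1%R[) g x)%E.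
Proof.
move=> g1 mg g0; rewrite -ge0_integral_itv_shift// add0r addrC.
exact: integral_period1.
Qed.

Lemma half_pow l : 2 ^- l = 2 ^- l.+1 + 2 ^- l.+1 :> R.
Proof. by rewrite exprS invfM -mulrDl -[2^-1]mul1r; field. Qed.

(** The unit interval splits into 2^l translates of a period of g. *)
Lemma integral_dyadic_period l u g :
  (forall x, g (x + 2 ^- l) = g x) ->
  measurable_fun setT g -> (forall x, (0 <= g x)%E) ->
  ((2 ^ l)%:R%:E * \int[mu]_(x in `[u, (u + 2 ^- l)%R[) g x =
   \int[mu]_(x in `[0%R, 1%R[) g x)%E.
Proof.
move=> + mg g0; elim: l u => [|l IH] u gl.
  by rewrite expn0 mul1e expr0 invr1 integral_period1// => x; rewrite -(gl x) expr0 invr1.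
have e2 := half_pow l.
rewrite -(IH u); last by move=> x; rewrite e2 addrA !gl.
rewrite (@ge0_integral_itv_cat u (u + 2 ^- l.+1) (u + 2 ^- l))//; last 2 first.
  by rewrite lerDl invr_ge0 exprn_ge0.
  by rewrite e2 addrA lerDl invr_ge0 exprn_ge0.
have -> : `[u + 2 ^- l.+1, u + 2 ^- l[%classic =
    `[u + 2 ^- l.+1, u + 2 ^- l.+1 + 2 ^- l.+1[%classic.
  by rewrite e2 addrA.
rewrite ge0_integral_itv_shift//; under [X in (_ = _ * (_ + X))%E]eq_integral do rewrite gl.
rewrite expnS natrM [(2%:R * _)%R]mulrC EFinM -muleA; congr (_ * _)%E.
by rewrite -[LHS]/(2%:R%:E * _)%E mule_natl mule2n.
Qed.

End periodic.

(** * Sums over dyadic cosets *)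

Section dyadic_cosets.
Context {R : realType}.
Local Notation mu := (@lebesgue_measure R).
Implicit Types (x : R) (h : R -> R).

(** The sum of h over x + 2^-l Z modulo 1. The recursive form makes each
refinement by a factor 2 a definitional step; see [fold_dyadicE] for the
explicit sum. *)
Fixpoint fold_dyadic (l : nat) (h : R -> R) (x : R) : R :=
  if l is l'.+1 then fold_dyadic l' h x + fold_dyadic l' h (x + 2 ^- l'.+1)
  else h x.

Lemma fold_dyadic_ge0 l h x : (forall y, 0 <= h y) -> 0 <= fold_dyadic l h x.
Proof. by move=> h0; elim: l x => [|l IH] x //=; rewrite addr_ge0. Qed.

Lemma le_fold_dyadic l k h x : (forall y, 0 <= h y) -> (l <= k)%N ->
  fold_dyadic l h x <= fold_dyadic k h x.
Proof.
move=> h0 /subnK <-; elim: (k - l)%N => [|n IH]; first by [].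
by rewrite addSn /= (le_trans IH)// lerDl fold_dyadic_ge0.
Qed.

Lemma measurable_fold_dyadic l h :
  measurable_fun setT h -> measurable_fun setT (fold_dyadic l h).
Proof.
move=> mh; elim: l => [|l IH] //=; apply: measurable_funD => //.
exact: measurableT_comp IH (measurable_shift _).
Qed.

Lemma fold_dyadic_periodic l h x : (forall y, h (y + 1) = h y) ->
  fold_dyadic l h (x + 2 ^- l) = fold_dyadic l h x.
Proof.
move=> h1; elim: l x => [|l IH] x /=; first by rewrite expr0 invr1 h1.
by rewrite -addrA -half_pow IH addrC.
Qed.

Lemma periodic_dyadicS (T : Type) l (h : R -> T) :
  (forall x, h (x + 2 ^- l.+1) = h x) -> forall x, h (x + 2 ^- l) = h x.
Proof. by move=> hl x; rewrite half_pow addrA !hl. Qed.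

Lemma periodic_dyadic_le (T : Type) l k (h : R -> T) : (k <= l)%N ->
  (forall x, h (x + 2 ^- l) = h x) -> forall x, h (x + 2 ^- k) = h x.
Proof.
move=> /subnK <-; elim: (l - k)%N => [//|n IH hl].
by apply: IH; apply: periodic_dyadicS.
Qed.

(** The factor q is constant on the coset over which the sum extends. *)
Lemma fold_dyadicMl l (q h : R -> R) x : (forall y, q (y + 2 ^- l) = q y) ->
  fold_dyadic l (fun y => q y * h y) x = q x * fold_dyadic l h x.
Proof.
elim: l x => [//|l IH] x ql /=.
have ql' := periodic_dyadicS ql.
by rewrite !IH// ql mulrDr.
Qed.

Lemma circle_integral_fold_dyadic l h : (forall y, h (y + 1) = h y) ->
  measurable_fun setT h -> (forall y, 0 <= h y) ->
  (\int[mu]_(x in `[0%R, 1%R[) (fold_dyadic l h x)%:E =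
   (2 ^ l)%:R%:E * \int[mu]_(x in `[0%R, 1%R[) (h x)%:E)%E.
Proof.
move=> h1 mh h0; elim: l => [|l IH]; first by rewrite expn0 mul1e.
have mf : measurable_fun setT (fold_dyadic l h) by exact: measurable_fold_dyadic.
have f0 x : 0 <= fold_dyadic l h x by exact: fold_dyadic_ge0.
under eq_integral do rewrite /= EFinD.
rewrite ge0_integralD//=; last 4 first.
- by move=> x _; rewrite lee_fin.
- by apply/measurable_EFinP; exact: measurable_funTS.
- by move=> x _; rewrite lee_fin.
- apply/measurable_EFinP; apply: measurable_funTS.
  exact: measurableT_comp mf (measurable_shift _).
rewrite (circle_integral_shift _ (g := EFin \o fold_dyadic l h))//=; last 2 first.
- move=> x; congr EFin; move: x.
  have -> : 1 = 2 ^- 0 :> R by rewrite expr0 invr1.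
  by apply: (@periodic_dyadic_le _ l) => // x; exact: fold_dyadic_periodic.
- exact/measurable_EFinP.
by rewrite IH -mule2n expnS natrM EFinM -muleA -[RHS]/(2%:R%:E * _)%E mule_natl.
Qed.

Lemma fold_dyadicE l h x :
  fold_dyadic l h x = \sum_(i < 2 ^ l) h (x + i%:R / 2 ^+ l).
Proof.
have dbl n (F : nat -> R) : \sum_(i < n.*2) F i =
    \sum_(i < n) F i.*2 + \sum_(i < n) F i.*2.+1.
  elim: n => [|n IH]; first by rewrite !big_ord0 addr0.
  by rewrite doubleS !big_ord_recr/= IH; ring.
elim: l x => [|l IH] x /=.
  by rewrite expn0 big_ord_recl big_ord0/= mul0r !addr0.
rewrite expnS mul2n (dbl _ (fun i => h (x + i%:R / 2 ^+ l.+1))) !IH.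
congr (_ + _); apply: eq_bigr => i _; congr h.
  by rewrite -mul2n exprS; field.
by rewrite -addrA -mul2n exprS; congr (_ + _); field.
Qed.
End dyadic_cosets.

(** * Dyadic zero-one law *)

Section zero_one.
Context {R : realType}.
Local Notation mu := (@lebesgue_measure R).
Implicit Types x u : R.

(** A ball of radius 2^-(l+1) has the length of a period of A, so the density
of A in such a ball is the measure c of A in the unit interval, whatever the
centre. At almost every point these densities tend to 0 or 1; therefore c is
0 or 1. *)
Lemma dyadic_zero_one (A : set R) : measurable A ->
  (forall l x, A (x + 2 ^- l) <-> A x) ->
  {ae mu, forall x, A x} \/ {ae mu, forall x, ~ A x}.
Proof.
move=> mA Ainv.
have indA l x : \1_A (x + 2 ^- l) = \1_A x :> R.
  rewrite !indicE; congr ((nat_of_bool _)%:R).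
  by apply/idP/idP; rewrite !inE => /Ainv.
have m1 : measurable_fun setT (EFin \o \1_A : R -> \bar R).
  by apply/measurable_EFinP; exact: measurable_indic.
have p1 x : (0 <= (EFin \o \1_A : R -> \bar R) x)%E by rewrite lee_fin.
pose c := mu (A `&` `[0, 1[).
have avg x l : (mu (A `&` ball x (2 ^- l.+1)) * (mu (ball x (2 ^- l.+1)))^-1 = c)%E.
  have l0 : 0 < 2 ^- l.+1 :> R by rewrite invr_gt0 exprn_gt0.
  rewrite lebesgue_measure_ball ?ltW//.
  have -> : mu (A `&` ball x (2 ^- l.+1)) =
      (\int[mu]_(y in `[(x - 2 ^- l.+1)%R, (x - 2 ^- l.+1 + 2 ^- l)%R[) (\1_A y)%:E)%E.
    rewrite -[LHS]integral_indic//; last exact: measurable_ball.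
    rewrite ball_itv (half_pow l) addrA subrK -integral_itv_obnd_cbnd//.
    exact: measurable_funTS.
  have -> : 2 ^- l.+1 *+ 2 = 2 ^- l :> R by rewrite (half_pow l) mulr2n.
  rewrite /c -(integral_indic mu (measurable_itv _) mA).
  rewrite -(@integral_dyadic_period R l (x - 2 ^- l.+1) (EFin \o \1_A))//=; last first.
    by move=> y; rewrite indA.
  rewrite inver gt_eqF ?invr_gt0 ?exprn_gt0// invrK muleC natrX.
  by [].
have lim0 : (fun l => 2 ^- l.+1 : R) @ \oo --> (0 : R).
  rewrite (cvg_shiftS (fun l => 2 ^- l : R)).
  under eq_fun do rewrite -exprVn.
  by apply: cvg_expr; rewrite ger0_norm ?invr_ge0// invf_lt1 ?ltr1n.
have dens : {ae mu, forall x, (\1_A x)%:E = c}.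
  have := lebesgue_density mA.
  apply: filter_app; first exact: (ae_filter_ringOfSetsType mu).
  apply: aeW => x /cvge_at_rightP /(_ (fun l => 2 ^- l.+1)) cvgx.
  have cvgc : (mu (A `&` ball x (2 ^- l.+1)) * (mu (ball x (2 ^- l.+1)))^-1)%E
      @[l --> \oo] --> (\1_A x)%:E.
    by apply: cvgx; split => // l; rewrite invr_gt0 exprn_gt0.
  rewrite -(cvg_lim (@ereal_hausdorff R) cvgc).
  have -> : (fun l : nat => mu (A `&` ball x (2 ^- l.+1)) *
      (mu (ball x (2 ^- l.+1)))^-1)%E = cst c by apply/funext => l; rewrite avg.
  exact: lim_cst.
have [c1|c1] := eqVneq c 1%E; [left|right]; move: dens;
  (apply: filter_app; first exact: (ae_filter_ringOfSetsType mu)); apply: aeW => x;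
  rewrite indicE => xc; [apply: contrapT => Ax|move=> Ax].
  by move: xc; rewrite c1 memNset// => -[] /eqP; rewrite eq_sym oner_eq0.
by move: c1; rewrite -xc mem_set// eqxx.
Qed.

Lemma negligible_periodic (Z : set R) : measurable Z ->
  (forall x, Z (x + 1) <-> Z x) -> mu (Z `&` `[0, 1[) = 0%E ->
  mu.-negligible Z.
Proof.
move=> mZ Z1 Z0.
have m1 : measurable_fun setT (EFin \o \1_Z : R -> \bar R).
  by apply/measurable_EFinP; exact: measurable_indic.
have per u : mu (Z `&` `[u, u + 1[) = 0%E.
  rewrite -Z0 -!integral_indic//.
  apply: (@integral_period1 _ u (EFin \o \1_Z)) => //=.
  move=> x; congr EFin; rewrite !indicE; congr ((nat_of_bool _)%:R).
  by apply/idP/idP; rewrite !inE => /Z1.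
pose N (n : nat) := (Z `&` `[n%:R, n%:R + 1[) `|` (Z `&` `[- n%:R - 1, - n%:R - 1 + 1[).
have : mu.-negligible (\bigcup_n N n).
  apply: negligible_bigcup => n; apply: negligibleU.
    by exists (Z `&` `[n%:R, n%:R + 1[); split; [exact: measurableI|exact: per|].
  by exists (Z `&` `[- n%:R - 1, - n%:R - 1 + 1[); split; [exact: measurableI|exact: per|].
apply: negligibleS => x Zx.
have := floor_le x; have := floorD1_gt x.
case: (Num.floor x) => n; rewrite intrD1 => xn nx; exists n => //; [left|right].
  by split => //=; rewrite in_itv/= nx.
by split => //=; rewrite in_itv/=; move: nx xn; rewrite NegzE mulrNz -pmulrn -natr1 => nx xn; lra.
Qed.
End zero_one.

(** * Maximal inequality for averages over dyadic cosets *)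

Section maximal.
Context {R : realType}.
Local Notation mu := (@lebesgue_measure R).
Local Notation I := (`[0%R, 1%R[%classic : set R).
Implicit Types (x u c : R) (h : R -> R).

(** The average of h over x + 2^-l Z is at least c. *)
Definition big_average c h l : set R := [set x | c * 2 ^+ l <= fold_dyadic l h x].

(** The union of [big_average c h j] for l <= j < l + n, built from the finest
scale down to the coarsest, as in the proof of [dyadic_maximal]. *)
Fixpoint big_averages c h n l : set R :=
  if n is n'.+1 then big_averages c h n' l.+1 `|` big_average c h l else set0.

Lemma measurable_big_average c h l : measurable_fun setT h ->
  measurable (big_average c h l).
Proof.
move=> mh; have := measurable_fun_ler (measurable_cst (c * 2 ^+ l)) (measurable_fold_dyadic l mh).
by move=> /(_ measurableT [set true] Logic.I); rewrite setTI.
Qed.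

Lemma measurable_big_averages c h n l : measurable_fun setT h ->
  measurable (big_averages c h n l).
Proof.
move=> mh; elim: n l => [|n IH] l /=; first exact: measurable0.
by apply: measurableU => //; exact: measurable_big_average.
Qed.

Lemma big_average_periodic c h l x : (forall y, h (y + 1) = h y) ->
  big_average c h l (x + 2 ^- l) = big_average c h l x.
Proof. by move=> h1; rewrite /big_average /= fold_dyadic_periodic. Qed.

Lemma big_averages_periodic c h n l x : (forall y, h (y + 1) = h y) ->
  big_averages c h n l (x + 2 ^- l) = big_averages c h n l x.
Proof.
move=> h1; elim: n l x => [//|n IH] l x /=.
congr (_ \/ _); last exact: big_average_periodic.
by apply: (@periodic_dyadicS _ _ l (big_averages c h n l.+1)) => y; exact: IH.
Qed.

Lemma big_averagesP c h n l x j : (l <= j < l + n)%N ->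
  c * 2 ^+ j <= fold_dyadic j h x -> big_averages c h n l x.
Proof.
elim: n l => [|n IH] l /=; first by lia.
have [-> _|lj] := eqVneq l j; first by right.
by move=> ? ?; left; apply: IH => //; lia.
Qed.

Lemma indic_periodic (A : set R) (t : R) : (forall x, A (x + t) = A x) ->
  forall x, \1_A (x + t) = \1_A x :> R.
Proof. by move=> At x; rewrite !indicE /in_mem/= /in_set At. Qed.

(** Since Y has period 2^-l, replacing h by its averages over the cosets of
2^-l Z preserves its integral on Y, and on Y these averages are at least c. *)
Lemma big_average_bound c h l (Y : set R) : 0 <= c ->
  (forall y, h (y + 1) = h y) -> measurable_fun setT h -> (forall y, 0 <= h y) ->
  measurable Y -> (forall x, Y (x + 2 ^- l) = Y x) -> Y `<=` big_average c h l ->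
  (c%:E * mu (Y `&` I) <= \int[mu]_(x in I) (\1_Y x * h x)%:E)%E.
Proof.
move=> c0 h1 mh h0 mY pY YG.
have mg : measurable_fun setT (fun x => \1_Y x * h x) by exact: measurable_funM.
have Y1 : forall x, Y (x + 1) = Y x.
  move=> x; have := @periodic_dyadic_le R _ l 0 Y isT pY x.
  by rewrite expr0 invr1.
rewrite -(@lee_pmul2l _ ((2 ^ l)%:R%:E))//.
rewrite -circle_integral_fold_dyadic//; last 2 first.
- by move=> y; rewrite (indic_periodic Y1) h1.
- by move=> y; rewrite mulr_ge0.
rewrite -integral_indic// -ge0_integralZl//=; last first.
  by apply/measurable_EFinP; exact: measurable_funTS.
rewrite -ge0_integralZl//=; last 2 first.
- by apply/measurable_EFinP; apply: measurable_funM => //; exact: measurable_funTS.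
- by move=> x _; rewrite mule_ge0// lee_fin.
apply: ge0_le_integral => //=.
- by move=> x _; rewrite !mule_ge0// lee_fin.
- apply: (measurable_comp (f := EFin) (F := setT)) => //.
  by apply: measurable_funM => //; apply: measurable_funM => //; exact: measurable_funTS.
- by apply/measurable_EFinP; apply: measurable_funTS; exact: measurable_fold_dyadic.
move=> x _; rewrite lee_fin (fold_dyadicMl _ (q := \1_Y)); last exact: indic_periodic.
rewrite indicE; have [/set_mem Yx|_] := boolP (x \in Y); last by rewrite !(mulr0, mul0r).
by rewrite mul1r mulr1 mulrC natrX; exact: YG.
Qed.

(** The stopping time argument for reverse martingales: the points are sorted
by the finest scale at which their average is large. A point whose first large
average occurs at scale l lies in the set Y below, of period 2^-l because the
conditions at finer scales have that period too. *)
Lemma dyadic_maximal c h n l : 0 <= c ->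
  (forall y, h (y + 1) = h y) -> measurable_fun setT h -> (forall y, 0 <= h y) ->
  (c%:E * mu (big_averages c h n l `&` I) <=
   \int[mu]_(x in I) (\1_(big_averages c h n l) x * h x)%:E)%E.
Proof.
move=> c0 h1 mh h0; elim: n l => [|n IH] l.
  by rewrite /= set0I measure0 mule0 integral_ge0// => x _; rewrite lee_fin mulr_ge0.
rewrite /=; set V := big_averages c h n l.+1.
pose Y := big_average c h l `\` V.
have mV : measurable V by exact: measurable_big_averages.
have mY : measurable Y by apply: measurableD => //; exact: measurable_big_average.
have -> : V `|` big_average c h l = V `|` Y.
  apply/seteqP; split => [x [Vx|Gx]|x [Vx|[Gx _]]]; [by left| |by left|by right].
  by have [Vx|nVx] := pselect (V x); [left|right].
have VY : V `&` Y = set0 by apply/seteqP; split => // x [Vx []].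
have pY x : Y (x + 2 ^- l) = Y x.
  congr (_ /\ ~ _); first exact: big_average_periodic.
  by apply: (@periodic_dyadicS _ _ l V) => y; exact: big_averages_periodic.
have indVY x : \1_(V `|` Y) x = \1_V x + \1_Y x :> R.
  rewrite !indicE in_setU.
  have [/set_mem Vx|] := boolP (x \in V); last by rewrite add0r.
  by rewrite memNset ?addr0// => Yx; have : (V `&` Y) x by []; rewrite VY.
have mul0 (A : set R) x : 0 <= \1_A x * h x by rewrite mulr_ge0.
have mmul (A : set R) : measurable A -> measurable_fun I (fun x => (\1_A x * h x)%:E).
  move=> mA; apply/measurable_EFinP; apply: measurable_funM; last exact: measurable_funTS.
  exact: measurable_indic.
rewrite setIUl measureU//=; last 3 first.
- exact: measurableI.
- exact: measurableI.
- by rewrite setIACA VY set0I.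
under eq_integral do rewrite indVY mulrDl EFinD.
rewrite ge0_integralD//=; last 4 first.
- by move=> x _; rewrite lee_fin.
- exact: mmul.
- by move=> x _; rewrite lee_fin.
- exact: mmul.
rewrite ge0_muleDr//; apply: leeD; first exact: IH.
by apply: (@big_average_bound _ _ l) => //; exact: subIsetl.
Qed.

Lemma dyadic_maximal_all c h : 0 < c ->
  (forall y, h (y + 1) = h y) -> measurable_fun setT h -> (forall y, 0 <= h y) ->
  (c%:E * mu ((\bigcup_l big_average c h l) `&` I) <= \int[mu]_(x in I) (h x)%:E)%E.
Proof.
move=> c0 h1 mh h0.
pose V n := big_averages c h n 0 `&` I.
have mV n : measurable (V n) by apply: measurableI => //; exact: measurable_big_averages.
have sub n l x : big_averages c h n l x -> exists2 j, (l <= j < l + n)%N & big_average c h j x.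
  elim: n l => [//|n IH] l /= [/IH[j lj Bj]|Bl]; first by exists j => //; lia.
  by exists l => //; lia.
have -> : (\bigcup_l big_average c h l) `&` I = \bigcup_n V n.
  apply/seteqP; split => [x [[j _ Bj] Ix]|x [n _ [/sub[j _ Bj] Ix]]].
    by exists j.+1 => //; split => //; apply: (big_averagesP (j := j)) => //; lia.
  by split => //; exists j.
have cvgV : (c%:E * mu (V n))%E @[n --> \oo] --> (c%:E * mu (\bigcup_n V n))%E.
  apply: cvgeZl => //; apply: nondecreasing_cvg_mu => //; first exact: bigcupT_measurable.
  move=> n m nm; apply/subsetPset => x [/sub[j j0 Bj] Ix]; split => //.
  by apply: (big_averagesP (j := j)) => //; lia.
rewrite -(cvg_lim (@ereal_hausdorff R) cvgV).
apply: lime_le; first by apply/cvg_ex; eexists; exact: cvgV.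
apply: nearW => n; apply: (le_trans (dyadic_maximal n 0 (ltW c0) h1 mh h0)).
have mB : measurable (big_averages c h n 0) by exact: measurable_big_averages.
apply: ge0_le_integral => //=.
- by move=> x _; rewrite lee_fin mulr_ge0.
- apply/measurable_EFinP; apply: measurable_funM; last exact: measurable_funTS.
  exact: measurable_indic.
- by apply/measurable_EFinP; exact: measurable_funTS.
by move=> x _; rewrite lee_fin ler_piMl// indicE lern1 leq_b1.
Qed.
End maximal.

(** * Shifting periodic terms by half a period *)

Section half_shift.
Context {R : realType}.
Local Notation mu := (@lebesgue_measure R).
Local Notation I := (`[0%R, 1%R[%classic : set R).
Implicit Types (x : R) (h : R -> R).

Lemma fold_dyadic_compl l h x :
  fold_dyadic l (fun y => 1 - h y) x = 2 ^+ l - fold_dyadic l h x.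
Proof.
elim: l x => [|l IH] x /=; first by rewrite expr0.
by rewrite !IH exprS; ring.
Qed.

(** On Y the average of the indicator of E over the coset of step 2^-(l+1) is
less than 1/4. Hence it is less than 1/2 over the half of this coset that
contains x + 2^-(l+1); q is constant on that half, and at least half of its
points lie outside E. *)
Lemma circle_integral_half_shift l (q : R -> R) (E Y : set R) :
  (forall x, q (x + 2 ^- l) = q x) -> measurable_fun setT q -> (forall x, 0 <= q x) ->
  (forall x, E (x + 1) = E x) -> measurable E -> measurable Y ->
  (forall x, Y x -> fold_dyadic l.+1 (\1_E) x < 4^-1 * 2 ^+ l.+1) ->
  (\int[mu]_(x in Y `&` I) (q (x + 2 ^- l.+1))%:E <=
   2%:E * \int[mu]_(x in I) (\1_(~` E) x * q x)%:E)%E.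
Proof.
move=> ql mq q0 E1 mE mY YE.
have q1 x : q (x + 1) = q x.
  by have := @periodic_dyadic_le R _ l 0 q isT ql x; rewrite expr0 invr1.
pose g x := q x * \1_(~` E) x.
have indC x : \1_(~` E) x = 1 - \1_E x :> R.
  by rewrite !indicE in_setC; case: (x \in E); rewrite ?subrr ?subr0.
have mg : measurable_fun setT g.
  by apply: measurable_funM => //; apply: measurable_indic; exact: measurableC.
have g0 x : 0 <= g x by rewrite mulr_ge0.
have g1 x : g (x + 1) = g x.
  by rewrite /g q1 !indC (indic_periodic E1).
have mfg : measurable_fun setT (fold_dyadic l g) by exact: measurable_fold_dyadic.
have p1 x : fold_dyadic l g (x + 1) = fold_dyadic l g x.
  have := @periodic_dyadic_le R _ l 0 (fold_dyadic l g) isT _ x.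
  by rewrite expr0 invr1; apply => y; exact: fold_dyadic_periodic.
have key x : Y x -> 2 ^+ l * q (x + 2 ^- l.+1) <= 2 * fold_dyadic l g (x + 2 ^- l.+1).
  move=> /YE /= bad; rewrite /g (fold_dyadicMl (\1_(~` E)))//.
  have {}bad : fold_dyadic l \1_E (x + 2 ^- l.+1) <= 2^-1 * 2 ^+ l.
    have : 0 <= fold_dyadic l \1_E x by exact: fold_dyadic_ge0.
    by move: bad; rewrite exprS; lra.
  have -> : \1_(~` E) = (fun y => 1 - \1_E y) :> (R -> R) by apply/funext.
  by rewrite fold_dyadic_compl mulrCA [leLHS]mulrC ler_wpM2l//; lra.
rewrite -(@lee_pmul2l _ ((2 ^ l)%:R%:E))//.
rewrite muleCA; under [X in (_ <= _ * (_ * X))%E]eq_integral do rewrite mulrC -[_ * _]/(g _).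
rewrite -circle_integral_fold_dyadic//.
rewrite -(@circle_integral_shift _ (2 ^- l.+1) (EFin \o fold_dyadic l g))//=; last 3 first.
- by move=> x; rewrite p1.
- exact/measurable_EFinP.
- by move=> x; rewrite lee_fin fold_dyadic_ge0.
have msq : measurable_fun setT (fun x => q (x + 2 ^- l.+1)).
  exact: measurableT_comp mq (measurable_shift _).
have msg : measurable_fun setT (fun x => fold_dyadic l g (x + 2 ^- l.+1)).
  exact: measurableT_comp mfg (measurable_shift _).
have sg0 x : 0 <= fold_dyadic l g (x + 2 ^- l.+1) by exact: fold_dyadic_ge0.
have mYI : measurable (Y `&` I) by exact: measurableI.
apply: (@le_trans _ _ (2%:E * \int[mu]_(x in Y `&` I) (fold_dyadic l g (x + 2 ^- l.+1))%:E)%E).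
  rewrite -!ge0_integralZl//=; last 4 first.
  - by apply/measurable_EFinP; exact: measurable_funTS.
  - by move=> x _; rewrite lee_fin.
  - by apply/measurable_EFinP; exact: measurable_funTS.
  - by move=> x _; rewrite lee_fin.
  apply: ge0_le_integral => //=.
  - by move=> x _; rewrite mule_ge0// lee_fin.
  - apply: (measurable_comp (f := EFin) (F := setT)) => //.
    by apply: measurable_funM => //; exact: measurable_funTS.
  - apply: (measurable_comp (f := EFin) (F := setT)) => //.
    by apply: measurable_funM => //; exact: measurable_funTS.
  by move=> x [Yx _]; rewrite -!EFinM lee_fin natrX; exact: key.
apply: lee_wpmul2l => //; apply: ge0_subset_integral => //=.
- by apply/measurable_EFinP; exact: measurable_funTS.
- by move=> x _; rewrite lee_fin.
Qed.

(** Let W and W' be the two sums, E n the set where W > n, and X n the set where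
some dyadic average of the indicator of E n is at least 1/4. Outside X n the
integral of W' over a period is at most 2 n, and the measure of X n in a period
is at most 4 times that of E n, which tends to 0. *)
Lemma ae_cvg_half_shift (F : nat -> R -> R) (s : nat -> nat) :
  (forall k x, 0 <= F k x) -> (forall k, measurable_fun setT (F k)) ->
  (forall k x, F k (x + 2 ^- s k) = F k x) ->
  {ae mu, forall x, (\sum_(0 <= k <oo) (F k x)%:E < +oo)%E} ->
  {ae mu, forall x, (\sum_(0 <= k <oo) (F k (x + 2 ^- (s k).+1)%R)%:E < +oo)%E}.
Proof.
move=> F0 mF pF aeF.
pose W x := (\sum_(0 <= k <oo) (F k x)%:E)%E.
pose W' x := (\sum_(0 <= k <oo) (F k (x + 2 ^- (s k).+1)%R)%:E)%E.
have mF' k : measurable_fun setT (fun x => F k (x + 2 ^- (s k).+1)).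
  exact: measurableT_comp (mF k) (measurable_shift _).
have mW : measurable_fun setT W.
  by apply: ge0_emeasurable_sum => [k x _ _|k _]; [rewrite lee_fin|exact/measurable_EFinP].
have mW' : measurable_fun setT W'.
  by apply: ge0_emeasurable_sum => [k x _ _|k _]; [rewrite lee_fin|exact/measurable_EFinP].
have W0 x : (0 <= W x)%E by apply: nneseries_ge0 => k _ _; rewrite lee_fin.
have W'0 x : (0 <= W' x)%E by apply: nneseries_ge0 => k _ _; rewrite lee_fin.
have F1 k x : F k (x + 1) = F k x.
  by have := @periodic_dyadic_le R _ (s k) 0 (F k) isT (pF k) x; rewrite expr0 invr1.
have W1 x : W (x + 1) = W x by apply: eq_eseriesr => k _; rewrite F1.
have W'1 x : W' (x + 1) = W' x by apply: eq_eseriesr => k _; rewrite addrAC F1.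
pose E n := [set x | (n%:R%:E < W x)%E].
have mE n : measurable (E n).
  rewrite -(setTI (E n)); exact: (emeasurable_fun_o_infty measurableT mW).
have E1 n x : E n (x + 1) = E n x by rewrite /E /= W1.
pose X n := \bigcup_l big_average 4^-1 (\1_(E n)) l.
have mE1 n : measurable_fun setT (\1_(E n) : R -> R) by exact: measurable_indic.
have mX n : measurable (X n).
  by apply: bigcupT_measurable => l; exact: measurable_big_average.
(* the factor 4 is the inverse of the level 1/4 *)
have muX n : (mu (X n `&` I) <= 4%:E * mu (E n `&` I))%E.
  have := @dyadic_maximal_all R 4^-1 (\1_(E n)) ltac:(by [])
    (indic_periodic (E1 n)) (mE1 n) ltac:(by []).
  rewrite (integral_indic mu (measurable_itv _) (mE n)) -/(X n) => /(lee_wpmul2l (_ : 0 <= 4%:E)%E).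
  by rewrite muleA -EFinM divff// mul1e; apply.
pose Z := [set x | W' x = +oo%E].
have mZ : measurable Z.
  rewrite -(setTI Z); exact: (mW' measurableT _ (emeasurable_set1 +oo%E)).
have mXI n : measurable (~` X n `&` I) by apply: measurableI => //; exact: measurableC.
(* off E n the sum W is at most n, and the half shift costs a factor 2 *)
have bound n : (\int[mu]_(x in ~` X n `&` I) W' x <= (2 * n%:R)%:E)%E.
  rewrite integral_nneseries//; last 3 first.
  - exact: mXI.
  - move=> k; apply/measurable_EFinP; exact: (measurable_funTS (mF' k)).
  - by move=> k x _; rewrite lee_fin.
  have mCF k : measurable_fun setT (fun x => \1_(~` E n) x * F k x).
    by apply: measurable_funM => //; apply: measurable_indic; exact: measurableC.
  apply: (@le_trans _ _ (\sum_(0 <= k <oo) 2%:E * \int[mu]_(x in I) (\1_(~` E n) x * F k x)%:E)%E).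
    apply: lee_nneseries => k *; first by apply: integral_ge0 => x _; rewrite lee_fin.
    apply: circle_integral_half_shift => //; first exact: measurableC.
    move=> x Xx; rewrite ltNge; apply/negP => bad; apply: Xx.
    by exists (s k).+1.
  rewrite nneseriesZl//; last by move=> k _; apply: integral_ge0 => x _; rewrite lee_fin mulr_ge0.
  rewrite EFinM; apply: lee_wpmul2l => //.
  rewrite -integral_nneseries//; last 2 first.
  - by move=> k; apply/measurable_EFinP; exact: (measurable_funTS (mCF k)).
  - by move=> k x _; rewrite lee_fin mulr_ge0.
  apply: (@le_trans _ _ (\int[mu]_(x in I) (cst n%:R%:E x))%E).
    apply: ge0_le_integral => //.
    - by move=> x _; apply: nneseries_ge0 => k _ _; rewrite lee_fin mulr_ge0.
    - apply: measurable_funTS; apply: ge0_emeasurable_sum => [k x _ _|k _].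
        by rewrite lee_fin mulr_ge0.
      by apply/measurable_EFinP; exact: mCF.
    move=> x _ /=; rewrite indicE in_setC.
    have [_|nEx] := boolP (x \in E n).
      by under eq_eseriesr do rewrite mul0r; rewrite eseries0// => *; rewrite mul0r.
    under eq_eseriesr do rewrite mul1r.
    by rewrite leNgt; apply/negP => En; move/negP: nEx; apply; rewrite inE.
  rewrite integral_cst//= lebesgue_measure_itv/= lte_fin ltr01 -EFinB subr0 mule1.
  by [].
have fin n : mu ((Z `&` (~` X n `&` I))) = 0%E.
  apply/negligibleP; first by apply: measurableI; [exact: mZ|exact: mXI].
  have /integrable_ae : mu.-integrable (~` X n `&` I) W'.
    apply/integrableP; split; first exact: measurable_funTS.
    under eq_integral do rewrite gee0_abs//.
    by rewrite (le_lt_trans (bound n))// ltry.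
  move=> /(_ (mXI n)); apply: negligibleS => x [Zx XIx] /= /(_ XIx).
  by rewrite Zx.
have ZX n : (mu (Z `&` I) <= 4%:E * mu (E n `&` I))%E.
  apply: (le_trans _ (muX n)); rewrite -[leRHS]add0e -(fin n).
  have mXnI : measurable (X n `&` I) by exact: measurableI.
  have mZXI : measurable (Z `&` (~` X n `&` I)) by exact: measurableI.
  have mZI : measurable (Z `&` I) by exact: measurableI.
  apply: (le_trans _ (measureU2 mu mZXI mXnI)); apply: le_measure; rewrite ?inE//.
    exact: measurableU.
  by move=> x [Zx Ix]; have [Xx|nXx] := pselect (X n x); [right|left].
have mEI n : measurable (E n `&` I) by exact: measurableI.
have E0 : mu (\bigcap_n (E n `&` I)) = 0%E.
  apply/negligibleP; first exact: bigcapT_measurable.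
  apply: negligibleS aeF => x Ex /= Wx.
  have /fineK Wfin : W x \is a fin_num by rewrite ge0_fin_numE//; exact: Wx.
  have [+ _] := Ex (Num.bound (fine (W x))) Logic.I.
  rewrite /E/= -Wfin lte_fin => /(lt_trans (archi_boundP (fine_ge0 (W0 x)))).
  by rewrite ltxx.
have Z0 : mu (Z `&` I) = 0%E.
  have cvgE : (4%:E * mu (E n `&` I))%E @[n --> \oo] --> (4%:E * 0)%E.
    apply: cvgeZl => //; rewrite -E0; apply: nonincreasing_cvg_mu => //.
    - apply: (@le_lt_trans _ _ (mu I)).
        apply: le_measure; [rewrite inE; exact: mEI| |exact: subIsetr].
        by rewrite inE; exact: measurable_itv.
      by rewrite lebesgue_measure_itv/= lte_fin ltr01 ltry.
    - exact: bigcapT_measurable.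
    move=> n m nm; apply/subsetPset => x [Ex Ix]; split => //.
    by apply: le_lt_trans Ex; rewrite lee_fin ler_nat.
  apply/eqP; rewrite eq_le measure_ge0 andbT -(mule0 4%:E).
  rewrite -(cvg_lim (@ereal_hausdorff R) cvgE).
  apply: lime_ge; first by apply/cvg_ex; eexists; exact: cvgE.
  by apply: nearW => n; exact: ZX.
apply: negligibleS (negligible_periodic mZ _ Z0) => [x /=|x].
  by rewrite ltey => /negP; rewrite negbK => /eqP.
by rewrite /Z /= W'1.
Qed.
End half_shift.

(** * Almost everywhere convergence of series of periodic functions *)

Section series.
Context {R : realType}.
Local Notation mu := (@lebesgue_measure R).
Implicit Types (x y : R).

Lemma ae_imply (P Q : R -> Prop) : (forall x, P x -> Q x) ->
  {ae mu, forall x, P x} -> {ae mu, forall x, Q x}.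
Proof. by move=> PQ; apply: negligibleS => x /= nQ /PQ. Qed.

Lemma ae_imply2 (P1 P2 Q : R -> Prop) : (forall x, P1 x -> P2 x -> Q x) ->
  {ae mu, forall x, P1 x} -> {ae mu, forall x, P2 x} -> {ae mu, forall x, Q x}.
Proof.
move=> PQ h1 h2; apply: negligibleS (negligibleU h1 h2) => x /= nQ.
by apply/not_andP => -[p1 p2]; exact/nQ/PQ.
Qed.

Lemma nneseries_lty_shift (u : nat -> R) K : (forall k, 0 <= u k) ->
  (\sum_(0 <= k <oo) (u k)%:E < +oo)%E = (\sum_(0 <= k <oo) (u (k + K)%N)%:E < +oo)%E.
Proof.
move=> u0; have uE0 k : (0 <= (u k)%:E)%E by rewrite lee_fin.
rewrite (nneseries_split 0 K)// add0n sumEFin.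
rewrite [in RHS](nneseries_addn (f := fun k => (u k)%:E))// .
have t0 : (0 <= \sum_(K <= k <oo) (u k)%:E)%E by exact: nneseries_ge0.
apply/idP/idP => [|h]; last by rewrite lte_add_pinfty ?ltry.
by apply: le_lt_trans; rewrite leeDr// lee_fin sumr_ge0.
Qed.

(** Deleting finitely many terms does not affect convergence, and the
remaining terms have any prescribed dyadic number as a period. *)
Lemma ae_series_zero_one (F : nat -> R -> R) (s : nat -> nat) :
  (forall k x, 0 <= F k x) -> (forall k, measurable_fun setT (F k)) ->
  (forall k x, F k (x + 2 ^- s k) = F k x) ->
  (forall l, exists K, forall k, (K <= k)%N -> (l <= s k)%N) ->
  {ae mu, forall x, (\sum_(0 <= k <oo) (F k x)%:E < +oo)%E} \/
  {ae mu, forall x, ~ (\sum_(0 <= k <oo) (F k x)%:E < +oo)%E}.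
Proof.
move=> F0 mF pF sinf.
pose W x := (\sum_(0 <= k <oo) (F k x)%:E)%E.
have mW : measurable_fun setT W.
  by apply: ge0_emeasurable_sum => [k x _ _|k _]; [rewrite lee_fin|exact/measurable_EFinP].
apply: (dyadic_zero_one (A := [set x | (W x < +oo)%E])).
  rewrite -(setTI [set x | _]); exact: (emeasurable_fun_infty_o measurableT mW).
move=> l x; rewrite /= /W; have [K hK] := sinf l.
rewrite (nneseries_lty_shift (u := fun k => F k (x + 2 ^- l)) K)//.
rewrite (nneseries_lty_shift (u := fun k => F k x) K)//.
under eq_eseriesr => k _.
  rewrite (@periodic_dyadic_le R _ (s (k + K)%N) l (F (k + K)%N) _ (pF _)).
    2: by apply: hK; rewrite leq_addl.
  over.
by [].
Qed.

(** Each halving of the step adds to the series its own half shift. *)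
Lemma ae_series_fold_raise (p : nat -> R -> R) (s : nat -> nat) B :
  (forall k x, 0 <= p k x) -> (forall k, measurable_fun setT (p k)) ->
  (forall k x, p k (x + 1) = p k x) ->
  {ae mu, forall x, (\sum_(0 <= k <oo) (fold_dyadic (s k) (p k) x)%:E < +oo)%E} ->
  {ae mu, forall x, (\sum_(0 <= k <oo) (fold_dyadic (s k + B) (p k) x)%:E < +oo)%E}.
Proof.
move=> p0 mp p1 h0.
elim: B => [|B IH].
  by apply: ae_imply h0 => x hx; under eq_eseriesr do rewrite addn0.
have half := @ae_cvg_half_shift R (fun k => fold_dyadic (s k + B) (p k)) (fun k => s k + B)%N
  (fun k x => fold_dyadic_ge0 _ _ (p0 k)) (fun k => measurable_fold_dyadic _ (mp k))
  (fun k x => fold_dyadic_periodic _ _ (p1 k)) IH.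
apply: ae_imply2 IH half => x h1 h2.
under eq_eseriesr do rewrite addnS /= EFinD.
rewrite nneseriesD; [|by move=> *; rewrite lee_fin fold_dyadic_ge0..].
by rewrite lte_add_pinfty.
Qed.
End series.

(** * Meshes and their translates *)

Section mesh.
Context {R : realType}.
Local Notation mu := (@lebesgue_measure R).
Implicit Types (x y : R) (f : R -> R) (m : nat -> nat).

Definition mesh_point m (k i : nat) : R := k%:R + i%:R / 2 ^+ m k.

Definition mesh m : set R :=
  [set l | exists k i, (i < 2 ^ m k)%N /\ l = mesh_point m k i].

Lemma mesh_point_ge m k i : k%:R <= mesh_point m k i.
Proof. by rewrite lerDl mulr_ge0// invr_ge0 exprn_ge0. Qed.

Lemma mesh_point_lt m k i : (i < 2 ^ m k)%N -> mesh_point m k i < k%:R + 1.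
Proof.
by move=> im; rewrite ltrD2l ltr_pdivrMr ?exprn_gt0// mul1r -natrX ltr_nat.
Qed.

Lemma mesh_point_block m k i k' : (i < 2 ^ m k)%N ->
  k'%:R <= mesh_point m k i < k'%:R + 1 -> k = k'.
Proof.
move=> im /andP[h1 h2]; apply/eqP; rewrite eqn_leq.
apply/andP; split; rewrite -ltnS -(ltr_nat R) -natr1.
  exact: le_lt_trans (mesh_point_ge m k i) h2.
exact: le_lt_trans h1 (mesh_point_lt im).
Qed.

Lemma mesh_point_inj m k i k' i' : (i < 2 ^ m k)%N -> (i' < 2 ^ m k')%N ->
  mesh_point m k i = mesh_point m k' i' -> (k, i) = (k', i').
Proof.
move=> ik ik' e; have kk : k = k'.
  by apply: (mesh_point_block ik); rewrite e mesh_point_ge mesh_point_lt.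
move: ik' e; rewrite -kk => ik' /addrI/mulIf e.
by congr pair; apply/eqP; rewrite -(eqr_nat R) e// invr_neq0// expf_neq0.
Qed.

Lemma translate_sum_mesh f m x : (forall y, 0 <= f y) ->
  translate_sum f (mesh m) x =
  (\sum_(0 <= k <oo) (fold_dyadic (m k) (fun y => f (y + k%:R)) x)%:E)%E.
Proof.
move=> f0; rewrite /translate_sum.
rewrite (@reindex_esum R _ _ (setT `*`` (fun k => `I_(2 ^ m k))) (mesh m)
  (fun ki => mesh_point m ki.1 ki.2)); last first.
  split.
  - by move=> [k i] /= [_ ik]; exists k, i.
  - move=> [k i] [k' i']; rewrite !inE/= => -[_ ik] [_ ik']; exact: mesh_point_inj.
  - by move=> _ [k [i [ik ->]]]; exists (k, i).
rewrite -(@esum_esum _ _ _ setT (fun k => `I_(2 ^ m k))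
   (fun k i => (f (x + mesh_point m k i))%:E)); last by move=> *; rewrite lee_fin.
rewrite nneseries_esumT; last by move=> k; rewrite lee_fin fold_dyadic_ge0.
apply: eq_esum => k _; rewrite esum_fset//; last by move=> *; rewrite lee_fin.
rewrite -fsbig_ord sumEFin fold_dyadicE; congr EFin; apply: eq_bigr => i _.
by rewrite /mesh_point addrCA addrC.
Qed.

Lemma measurable_floor : measurable_fun setT (fun x : R => (Num.floor x)%:~R : R).
Proof.
apply: nondecreasing_measurable => // x y xy; rewrite ler_int.
exact: le_floor.
Qed.

(** The restriction of f to [j, j + 1), repeated with period 1. *)
Definition wrap f (j : int) x : R := f (j%:~R + (x - (Num.floor x)%:~R)).

Lemma wrap_periodic f j x : wrap f j (x + 1) = wrap f j x.
Proof.
rewrite /wrap; have -> : Num.floor (x + 1) = Num.floor x + 1.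
  by rewrite floorDrz ?floor1.
by rewrite intrD; congr f; ring.
Qed.

Lemma measurable_wrap f j : measurable_fun setT f -> measurable_fun setT (wrap f j).
Proof.
move=> mf; apply: measurableT_comp mf _; apply: measurable_funD => //.
by apply: measurable_funB => //; exact: measurable_floor.
Qed.

(** The bit b tells whether x + t has left the unit interval of x. *)
Lemma wrap_shift f x (t : R) : 0 <= t < 1 -> exists b : bool, forall j,
  wrap f j (x + t) = f (x + t + (j - Num.floor x)%:~R - b%:R).
Proof.
move=> /andP[t0 t1]; rewrite /wrap.
have [lt|ge] := ltP (x + t) (Num.floor x + 1)%:~R; [exists false|exists true] => j.
  have -> : Num.floor (x + t) = Num.floor x.
    by apply: floor_def; rewrite lt andbT (le_trans (floor_le x))// lerDl.
  by rewrite intrB /= subr0; congr f; ring.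
have -> : Num.floor (x + t) = Num.floor x + 1.
  apply: floor_def; rewrite ge/= intrD; apply: ltrD => //; exact: floorD1_gt.
by rewrite !intrD !mulrNz /=; congr f; ring.
Qed.

Lemma dyadic_fraction l (i : 'I_(2 ^ l)) : 0 <= (i%:R / 2 ^+ l : R) < 1.
Proof.
rewrite mulr_ge0 ?invr_ge0 ?exprn_ge0//= ltr_pdivrMr ?exprn_gt0//.
by rewrite mul1r -natrX ltr_nat.
Qed.

(** The points x + k + t with 0 <= t < 1 lie in two consecutive unit
intervals, and f on either one is a wrapped piece of f. *)
Lemma fold_le_wrap f l k x : (forall y, 0 <= f y) ->
  fold_dyadic l (fun y => f (y + k%:R)) x <=
  fold_dyadic l (wrap f (Num.floor x + k%:Z)) x +
  fold_dyadic l (wrap f (Num.floor x + 1 + k%:Z)) x.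
Proof.
move=> f0; rewrite !fold_dyadicE -big_split/=; apply: ler_sum => i _.
have [b wE] := wrap_shift f x (dyadic_fraction i); rewrite !wE.
have -> : (Num.floor x + k%:Z - Num.floor x)%:~R = k%:R :> R by rewrite intrD mulrNz intrD; ring.
have -> : (Num.floor x + 1 + k%:Z - Num.floor x)%:~R = k%:R + 1 :> R.
  by rewrite !intrD mulrNz; ring.
by case: b {wE}; rewrite ?subr0 ?addrA ?addrK ?lerDl ?lerDr.
Qed.

(** Over the points x + t, the wrapped piece takes values of f at x + t + k
when x + t has left the unit interval of x, and at x + t + k + 1 otherwise;
both are points of the translated mesh if the grid of step 2^-l is used in
these two blocks. *)
Lemma wrap_le_fold f l k x : (forall y, 0 <= f y) ->
  fold_dyadic l (wrap f (Num.floor x + 1 + k%:Z)) x <=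
  fold_dyadic l (fun y => f (y + k%:R)) x + fold_dyadic l (fun y => f (y + k.+1%:R)) x.
Proof.
move=> f0; rewrite !fold_dyadicE -big_split/=; apply: ler_sum => i _.
have [b wE] := wrap_shift f x (dyadic_fraction i); rewrite !wE.
have -> : (Num.floor x + 1 + k%:Z - Num.floor x)%:~R = k%:R + 1 :> R.
  by rewrite !intrD mulrNz; ring.
by rewrite -(natr1 k); case: b {wE}; rewrite ?subr0 ?addrA ?addrK ?lerDl ?lerDr.
Qed.

(** The series T_a, which replaces the sum over the translated mesh by terms
that are periodic on the whole line. *)
Definition wrap_sum f m (a : int) x : \bar R :=
  (\sum_(0 <= k <oo) (fold_dyadic (m k) (wrap f (a + k%:Z)) x)%:E)%E.

Lemma translate_sum_le f m x : (forall y, 0 <= f y) ->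
  (translate_sum f (mesh m) x <=
   wrap_sum f m (Num.floor x) x + wrap_sum f m (Num.floor x + 1) x)%E.
Proof.
move=> f0; have w0 j y : 0 <= wrap f j y by exact: f0.
rewrite translate_sum_mesh// /wrap_sum -nneseriesD;
  [|by move=> *; rewrite lee_fin fold_dyadic_ge0..].
apply: lee_nneseries => k *; first by rewrite lee_fin fold_dyadic_ge0.
by rewrite -EFinD lee_fin fold_le_wrap.
Qed.

(** The block k of the mesh is used for the terms k - 1 and k of the series,
whence the factor 2; for the former, the block is finer than needed. *)
Lemma wrap_sum_le f m x : (forall y, 0 <= f y) ->
  (forall k, (m k <= m k.+1)%N) ->
  (wrap_sum f m (Num.floor x + 1) x <= 2%:E * translate_sum f (mesh m) x)%E.
Proof.
move=> f0 mm; have w0 j y : 0 <= wrap f j y by exact: f0.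
rewrite translate_sum_mesh//.
pose u k := fold_dyadic (m k) (fun y => f (y + k%:R)) x.
have u0 k : 0 <= u k by exact: fold_dyadic_ge0.
apply: (@le_trans _ _ (\sum_(0 <= k <oo) ((u k)%:E + (u k.+1)%:E))%E).
  apply: lee_nneseries => k *; first by rewrite lee_fin fold_dyadic_ge0.
  rewrite -EFinD lee_fin (le_trans (wrap_le_fold _ _ _ f0))// lerD2l.
  exact: le_fold_dyadic.
rewrite nneseriesD; [|by move=> *; rewrite lee_fin..].
rewrite -[2%:E]/(1 + 1)%E ge0_muleDl// !mul1e leeD2l//.
have -> : (\sum_(0 <= k <oo) (u k.+1)%:E = \sum_(1 <= k <oo) (u k)%:E)%E.
  rewrite -(nneseries_addn (f := fun k => (u k)%:E) 1)//.
  by apply: eq_eseriesr => k _; rewrite addn1.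
rewrite -[leRHS]/(\sum_(0 <= k <oo) (u k)%:E)%E.
rewrite (@nneseries_split _ (fun k => (u k)%:E) 0 1); last by move=> k _; rewrite lee_fin.
by rewrite add0n leeDr// sumEFin lee_fin sumr_ge0.
Qed.

(** Both series sum the same wrapped pieces; that of a + 1 does so over the
cosets belonging to the previous block, which are coarser. *)
Lemma wrap_sum_succ f m a x : (forall y, 0 <= f y) ->
  (forall k, (m k <= m k.+1)%N) ->
  (wrap_sum f m a x < +oo)%E -> (wrap_sum f m (a + 1) x < +oo)%E.
Proof.
move=> f0 mm; have w0 j y : 0 <= wrap f j y by exact: f0.
rewrite /wrap_sum (nneseries_lty_shift (u := fun k => fold_dyadic (m k) (wrap f (a + k%:Z)) x) 1).
  apply: le_lt_trans; apply: lee_nneseries => k *; first by rewrite lee_fin fold_dyadic_ge0.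
  by rewrite lee_fin addn1 -addrA -intS le_fold_dyadic.
by move=> k; rewrite fold_dyadic_ge0.
Qed.

(** Here the cosets become finer, and the bound on the jumps makes finitely
many halvings sufficient. *)
Lemma ae_wrap_sum_pred f m a B : (forall y, 0 <= f y) -> measurable_fun setT f ->
  (forall k, (m k.+1 <= m k + B)%N) ->
  {ae mu, forall x, (wrap_sum f m (a + 1) x < +oo)%E} ->
  {ae mu, forall x, (wrap_sum f m a x < +oo)%E}.
Proof.
move=> f0 mf mB aeT; have w0 j y : 0 <= wrap f j y by exact: f0.
have := @ae_series_fold_raise R (fun k => wrap f (a + 1 + k%:Z)) m B (fun k => w0 _)
  (fun k => measurable_wrap _ mf) (fun k => wrap_periodic _ _) aeT.
apply: ae_imply => x.
rewrite /wrap_sum (nneseries_lty_shift (u := fun k => fold_dyadic (m k) (wrap f (a + k%:Z)) x) 1).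
  apply: le_lt_trans; apply: lee_nneseries => k *; first by rewrite lee_fin fold_dyadic_ge0.
  by rewrite lee_fin addn1 -addrA -intS le_fold_dyadic.
by move=> k; rewrite fold_dyadic_ge0.
Qed.

Lemma ae_forall_int (P : int -> R -> Prop) :
  (forall a, {ae mu, forall x, P a x}) -> {ae mu, forall x, forall a, P a x}.
Proof.
move=> h.
have := @ae_foralln _ _ R mu (fun n x => if unpickle n is Some a then P a x else True).
move=> /(_ _)/ae_imply; apply; first by move=> x Px a; have := Px (pickle a); rewrite pickleK.
by move=> n; case: (unpickle n) => [a|]; [exact: h|exact: aeW].
Qed.

(** If one of the comparison series is finite almost everywhere, then all of
them are, and with them the sum over the mesh. Otherwise all are infinite
almost everywhere, and the sum is too. *)
Lemma mesh_zero_one_borel f m B : (forall y, 0 <= f y) -> measurable_fun setT f ->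
  (forall k, (m k <= m k.+1 <= m k + B)%N) ->
  (forall l, exists k, (l <= m k)%N) ->
  mu.-negligible (div_set f (mesh m)) \/ mu.-negligible (conv_set f (mesh m)).
Proof.
move=> f0 mf mB minf.
have mm k : (m k <= m k.+1)%N by case/andP: (mB k).
have mb k : (m k.+1 <= m k + B)%N by case/andP: (mB k).
have minf' l : exists K, forall k, (K <= k)%N -> (l <= m k)%N.
  have [K lK] := minf l; exists K => k Kk; apply: (leq_trans lK).
  exact: (homo_leq leqnn leq_trans mm).
have w0 j y : 0 <= wrap f j y by exact: f0.
have zo a : {ae mu, forall x, (wrap_sum f m a x < +oo)%E} \/
    {ae mu, forall x, ~ (wrap_sum f m a x < +oo)%E}.
  apply: (@ae_series_zero_one R (fun k => fold_dyadic (m k) (wrap f (a + k%:Z))) m) => //.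
  - by move=> k x; exact: fold_dyadic_ge0.
  - by move=> k; apply: measurable_fold_dyadic; exact: measurable_wrap.
  - by move=> k x; apply: fold_dyadic_periodic; exact: wrap_periodic.
have [[a ha]|none] := pselect (exists a, {ae mu, forall x, (wrap_sum f m a x < +oo)%E}).
  left; have all b : {ae mu, forall x, (wrap_sum f m b x < +oo)%E}.
    have up (n : nat) : {ae mu, forall x, (wrap_sum f m (a + n%:Z) x < +oo)%E}.
      elim: n => [|n IH]; first by rewrite addr0.
      rewrite -addn1 PoszD addrA.
      by apply: ae_imply IH => x; exact: wrap_sum_succ.
    have down (n : nat) : {ae mu, forall x, (wrap_sum f m (a - n%:Z) x < +oo)%E}.
      elim: n => [|n IH]; first by rewrite subr0.
      apply: (ae_wrap_sum_pred (B := B)) => //.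
      by rewrite -addn1 PoszD opprD addrA subrK.
    have [ab|ba] := leP a b.
      have <- : a + (`|b - a|%N)%:Z = b by lia.
      exact: up.
    have <- : a - (`|b - a|%N)%:Z = b by lia.
    exact: down.
  apply: negligibleS (ae_forall_int all) => x Dx /= fin.
  have := translate_sum_le m x f0; rewrite Dx leye_eq => /eqP e.
  by have := lte_add_pinfty (fin (Num.floor x)) (fin (Num.floor x + 1)); rewrite e ltxx.
right; have all a : {ae mu, forall x, ~ (wrap_sum f m a x < +oo)%E}.
  by have [ha|//] := zo a; exfalso; apply: none; exists a.
apply: negligibleS (ae_forall_int all) => x Cx /= inf.
apply: (inf (Num.floor x + 1)); apply: (le_lt_trans (wrap_sum_le x f0 mm)).
rewrite lte_mul_pinfty//.
Qed.

End mesh.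

(** * Meshes of type 1 *)

Section completion.
Context {R : realType}.
Local Notation mu := (@lebesgue_measure R).
Implicit Types (x y : R) (f : R -> R) (m : nat -> nat).

Lemma completed_negligible (A : set R) : mu.-negligible A ->
  completed_lebesgue_measure A = 0%E.
Proof.
move=> [N [mN N0 AN]]; apply/eqP; rewrite eq_le; apply/andP; split.
  by rewrite -N0; exact: le_outer_measure.
exact: outer_measure_ge0.
Qed.

(** Each set where f exceeds a rational is Borel up to a Borel null set. The
new function is 0 on the union of these countably many null sets. *)
Lemma borel_modification f : (forall x, 0 <= f x) -> lebesgue_measurable_fun f ->
  exists g : R -> R, [/\ measurable_fun setT g, (forall x, 0 <= g x) &
    exists N : set R, [/\ measurable N, mu N = 0%E & forall x, ~ N x -> f x = g x]].
Proof.
move=> f0 mf.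
have split_meas (q : rat) : exists AN : set R * set R,
    [/\ measurable AN.1, measurable AN.2, mu AN.2 = 0%E &
     [set x | ratr q < f x] `\` AN.2 = AN.1 `\` AN.2].
  have : ((wlength (@idfun R))^*%mu).-cara.-measurable [set x | ratr q < f x].
    have := mf measurableT `]ratr q, +oo[%classic (measurable_itv _).
    rewrite setTI; congr (_.-cara.-measurable _).
    by apply/seteqP; split => x /=; rewrite in_itv/= andbT.
  rewrite -completed_caratheodory_measurable g_sigma_completed_algebra_genE.
  move=> [A mA [N [N' [mN' N'0 NN']]] AN]; exists (A, N'); split => //=.
  rewrite -AN; apply/seteqP; split => [x [[Ax|Nx] nNx]|x [Ax nNx]].
  - by [].
  - by exfalso; apply: nNx; exact: NN'.
  - by split => //; left.
pose AN q := sval (cid (split_meas q)).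
have ANP q := svalP (cid (split_meas q)).
pose N := \bigcup_n (if unpickle n is Some q then (AN q).2 else set0).
have mN : measurable N.
  by apply: bigcupT_measurable => n; case: (unpickle n) => [q|//]; have [] := ANP q.
have N0 : mu N = 0%E.
  apply/negligibleP => //; apply: negligible_bigcup => n.
  case: (unpickle n) => [q|]; last exact: negligible_set0.
  by have [_ h1 h2 _] := ANP q; apply/negligibleP.
have subN q : (AN q).2 `<=` N.
  by move=> x ANx; exists (pickle q); [exact: Logic.I|rewrite pickleK].
exists (fun x => f x * \1_(~` N) x); split; last 2 first.
- by move=> x; rewrite mulr_ge0.
- by exists N; split => // x nNx; rewrite indicE mem_set// mulr1.
apply: (measurability _ (RGenOInfty.measurableE R)) => //.
move=> _ [_ [a ->] <-]; rewrite setTI.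
have [a0|a0] := ltP a 0.
  have -> : (fun x => f x * \1_(~` N) x) @^-1` `]a, +oo[%classic = setT.
    apply/seteqP; split => // x _; rewrite /= in_itv/= andbT.
    by rewrite (lt_le_trans a0)// mulr_ge0.
  exact: measurableT.
have -> : (fun x => f x * \1_(~` N) x) @^-1` `]a, +oo[%classic =
    \bigcup_(q : rat) (if a < ratr q then (AN q).1 `\` N else set0).
  apply/seteqP; split => [x|x [q _]].
    rewrite /= in_itv/= andbT indicE.
    have [/set_mem nNx|_] := boolP (x \in ~` N); last first.
      by rewrite mulr0 => /(le_lt_trans a0); rewrite ltxx.
    rewrite mulr1 => afx.
    have [q] := rat_in_itvoo afx; rewrite in_itv/= => /andP[aq qf].
    exists q => //; rewrite aq; split => //.
    have [_ _ _ eq] := ANP q.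
    suff : ((AN q).1 `\` (AN q).2) x by case.
    by rewrite -eq; split => // /(subN q).
  case: ifPn => // aq [Ax nNx]; rewrite /= in_itv/= andbT indicE mem_set// mulr1.
  have [_ _ _ eq] := ANP q.
  suff [qf _] : ([set x | ratr q < f x] `\` (AN q).2) x by exact: lt_trans aq qf.
  by rewrite eq; split => // /(subN q).
apply: bigcupT_measurable_rat => q; case: ifPn => // _.
by apply: measurableD => //; have [] := ANP q.
Qed.

(** Changing f on a null set N changes the sum only on the union of the
translates of N by the opposites of the mesh points, which is null. *)
Lemma mesh_type1 m B : (forall k, (m k <= m k.+1 <= m k + B)%N) ->
  (forall l, exists k, (l <= m k)%N) -> type1 (mesh m : set R).
Proof.
move=> mB minf f f0 mf.
have [g [mg g0 [N [mN N0 fg]]]] := borel_modification f0 mf.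
pose D := \bigcup_k \bigcup_i [set x | N (x + mesh_point m k i)].
have negD : mu.-negligible D.
  apply: negligible_bigcup => k; apply: negligible_bigcup => i.
  exists [set x | N (x + mesh_point m k i)]; split => //.
    rewrite -(setTI [set x | _]).
    exact: (measurable_shift (mesh_point m k i) measurableT mN).
  by rewrite -N0; exact: (lebesgue_measure_shift (mesh_point m k i) mN).
have sumE x : ~ D x -> translate_sum f (mesh m) x = translate_sum g (mesh m) x.
  move=> nDx; apply: eq_esum => _ [k [i [_ ->]]]; congr EFin; apply: fg => Nx.
  by apply: nDx; exists k => //; exists i.
have transfer (P : \bar R -> Prop) :
    mu.-negligible [set x | P (translate_sum g (mesh m) x)] ->
    mu.-negligible [set x | P (translate_sum f (mesh m) x)].
  move=> /negligibleU/(_ negD); apply: negligibleS => x /= Px.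
  have [Dx|nDx] := pselect (D x); [by right|left].
  by rewrite /= -sumE.
have [h|h] := mesh_zero_one_borel g0 mg mB minf; [left|right];
  apply: completed_negligible.
  exact: (transfer (fun e => e = +oo%E)).
exact: (transfer (fun e => e < +oo)%E).
Qed.
End completion.

(** * Admissibility *)

Section admissibility.
Context {R : realType}.
Implicit Types (x : R) (m : nat -> nat).

Lemma mesh_nat m k : (mesh m : set R) k%:R.
Proof. by exists k, 0%N; rewrite expn_gt0 /mesh_point mul0r addr0. Qed.

Lemma mesh_admissible m : admissible (mesh m : set R).
Proof.
have nat_inj : injective (fun n : nat => n%:R : R) by move=> a b /eqP; rewrite eqr_nat => /eqP.
split.
- apply: (@sub_countable _ _ _ ((fun ki => mesh_point m ki.1 ki.2) @` [set: nat * nat])).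
    by apply: subset_card_le => _ [k [i [_ ->]]]; exists (k, i).
  exact: card_le_trans (card_image_le _ _) (countableP _).
- move=> finm; apply: infinite_nat.
  apply: (@sub_finite_set _ _ ((fun n : nat => n%:R : R) @^-1` mesh m)).
    by move=> n _; exact: mesh_nat.
  by apply: finite_preimage => // a b _ _; exact: nat_inj.
- move=> /ex_strict_bound_gt0[M M0 hM].
  have := hM _ (mesh_nat m (Num.bound M)).
  rewrite /= ger0_norm// => /(lt_trans (archi_boundP (ltW M0))).
  by rewrite ltxx.
- exists 0 => _ [k [i [_ ->]]]; exact: le_trans (mesh_point_ge m k i).
apply/seteqP; split => // t /= limt.
pose K := Num.bound (`|t| + 1).
pose A := \bigcup_(k in `I_K) ((fun i => mesh_point m k i : R) @` `I_(2 ^ m k)).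
have finA : finite_set A.
  by apply: bigcup_finite => // k _; exact: finite_image.
have clA : closed (A `\ t).
  have /accessible_finite_set_closed := hausdorff_accessible (@Rhausdorff R).
  by apply; exact: finite_setD.
have [] := limt (~` (A `\ t) `&` `]-oo, t + 1[%classic).
  apply: filterI; last first.
    apply: open_nbhs_nbhs; split; first exact: interval_open.
    by rewrite /= in_itv/= ltrDl.
  apply: open_nbhs_nbhs; split; first exact: closed_openC.
  by move=> [_]; apply.
move=> y [yt [k [i [ik yE]]] [nA]]; rewrite /= in_itv/= => yt1.
apply: nA; split; last by move/eqP : yt.
exists k; last by exists i.
rewrite /= -(ltr_nat R).
have kt : k%:R < `|t| + 1.
  apply: (@le_lt_trans _ _ y); first by rewrite yE; exact: mesh_point_ge.
  by rewrite (lt_le_trans yt1)// lerD2r ler_norm.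
by apply: (lt_trans kt); apply: archi_boundP; rewrite addr_ge0.
Qed.
End admissibility.

(** * Meshes of type 2 *)

Section large_jumps.
Context {R : realType}.
Local Notation mu := (@lebesgue_measure R).
Implicit Types (x : R) (m : nat -> nat).

Lemma translate_sum_indic_pinfty (J L : set R) x (l : nat -> R) :
  injective l -> (forall p, L (l p)) -> (forall p, J (x + l p)) ->
  translate_sum (\1_J) L x = +oo%E.
Proof.
move=> linj lL lJ; apply/eqyP => M M0; apply: esum_ge.
pose n := Num.bound M; pose X := l @` `I_n.
have finX : finite_set X by exact: finite_image.
exists X; first by split => // _ [p _ <-].
rewrite -esum_fset//.
rewrite (@reindex_esum R _ _ `I_n X l); last first.
  split; [by move=> p pn; exists p|by move=> a b _ _; exact: linj|by []].
rewrite esum_fset//.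
rewrite -fsbig_ord sumEFin lee_fin.
under eq_bigr do rewrite indicE mem_set//.
rewrite sumr_const card_ord ltW// archi_boundP// ltW//.
Qed.

(** The function is the indicator of J, the union of the intervals
]n, n + q] where n = K p + 1 and q is the step of the mesh in [n, n + 1). On D
the translated mesh meets all of them, and on C it does so only in the sets
B p. The increment p + 3 makes the measures of the B p add up to at most 1/4,
half of the measure of C. *)
Lemma mesh_type2 m (K : nat -> nat) : injective K ->
  (forall p, (m (K p) + p + 3 <= m (K p).+1)%N) -> type2 (mesh m : set R).
Proof.
move=> Kinj jump.
pose n p := (K p).+1; pose q p : R := 2 ^- m (n p).
pose J := \bigcup_p `](n p)%:R, (n p)%:R + q p]%classic.
have q_lt p : 0 < q p < 2^-1.
  rewrite invr_gt0 exprn_gt0//= ltf_pV2 ?posrE ?exprn_gt0// -natrX ltr_nat.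
  by rewrite -[ltnLHS](expn1 2) ltn_exp2l//; have := jump p; rewrite -/(n p); lia.
have mJ : measurable J by apply: bigcupT_measurable.
pose D : set R := `]- 2^-1, 0[%classic; pose C : set R := `[2^-1, 1[%classic.
have divD : D `<=` div_set (\1_J) (mesh m).
  move=> x; rewrite /D /= in_itv/= => /andP[x1 x2].
  (* the first point of the grid whose translate by x lies beyond n p *)
  pose i p := (Num.trunc (- x * 2 ^+ m (n p))).+1.
  have iP p : (i p < 2 ^ m (n p))%N /\ - x < (i p)%:R * q p <= - x + q p.
    have e0 : 0 < 2 ^+ m (n p) :> R by rewrite exprn_gt0.
    have /andP[q0 q1] := q_lt p.
    have qe : q p * 2 ^+ m (n p) = 1 by rewrite mulVf// gt_eqF.
    have /truncn_itv : 0 <= - x * 2 ^+ m (n p) by rewrite mulr_ge0 ?ltW// oppr_gt0.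
    rewrite -(natr1 (Num.trunc _)) => /andP[t1 t2]; rewrite -(ltr_nat R) natrX.
    split.
      have e2 : 1 < 2^-1 * 2 ^+ m (n p) :> R by rewrite -[ltLHS]qe ltr_pM2r.
      have ex : - x * 2 ^+ m (n p) < 2^-1 * 2 ^+ m (n p) by rewrite ltr_pM2r// ltrNl.
      by rewrite -(natr1 (Num.trunc _)); lra.
    apply/andP; split; first by rewrite -(ltr_pM2r e0) -mulrA qe mulr1.
    by rewrite -(ler_pM2r e0) -mulrA qe mulr1 mulrDl qe lerD2r.
  apply: (@translate_sum_indic_pinfty J _ x (fun p => mesh_point m (n p) (i p))).
  - by move=> p p' /(mesh_point_inj (iP p).1 (iP p').1)[/Kinj].
  - by move=> p; exists (n p), (i p); split => //; exact: (iP p).1.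
  - move=> p; exists p => //; rewrite /= in_itv/= /mesh_point -/(q p).
    by have [_ /andP[i1 i2]] := iP p; lra.
(* the x whose translate carries the i-th point of the block K p into the p-th interval *)
pose S (p i : nat) : set R :=
  `](n p)%:R - mesh_point m (K p) i, (n p)%:R - mesh_point m (K p) i + q p]%classic.
pose B p := \big[setU/set0]_(i < 2 ^ m (K p)) S p i.
have convC : C `\` (\bigcup_p B p) `<=` conv_set (\1_J) (mesh m).
  move=> x [Cx nBx]; rewrite /conv_set /=.
  suff -> : translate_sum (\1_J) (mesh m) x = 0%E by exact: ltry.
  apply: esum1 => _ [k [i [ik ->]]]; rewrite indicE.
  have [/set_mem [p _] Jx|//] := boolP (_ \in J); exfalso; apply: nBx.
  exists p => //; move: Cx Jx; rewrite /C /= !in_itv/= => /andP[x1 x2] /andP[l1 l2].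
  have /andP[q0 q1] := q_lt p.
  (* x >= 1/2 and q p < 1/2 keep the mesh point inside the block K p *)
  have kE : k = K p.
    apply: (mesh_point_block (R := R) ik); move: l1 l2; rewrite /n -natr1 -/(q p) => l1 l2.
    by apply/andP; split; lra.
  rewrite /B -bigcup_mkord; exists i; first by rewrite /= -kE.
  by rewrite /S /= in_itv/= -kE; apply/andP; split; lra.
have mS p i : measurable (S p i) by exact: measurable_itv.
have muB p : (mu (B p) <= (1 / (2 ^ (p + 3))%:R)%:E)%E.
  have /andP[q0 _] := q_lt p.
  apply: (le_trans (@Boole_inequality _ _ _ mu (S p) _ _)); first by move=> i _; exact: mS.
  have muS i : mu (S p i) = (q p)%:E.
    by rewrite /S lebesgue_measure_itv/= lte_fin ltrDl q0 -EFinB addrC addKr.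
  rewrite (eq_bigr (fun=> (q p)%:E)); last by move=> i _; exact: muS.
  rewrite sumEFin lee_fin sumr_const card_ord -(mulr_natr (q p)) !natrX.
  rewrite ler_pdivlMr ?exprn_gt0// -mulrA -exprD mulrC ler_pdivrMr ?exprn_gt0// mul1r.
  by rewrite -!natrX ler_nat leq_exp2l//; have := jump p; rewrite -/(n p); lia.
have mBp p : measurable (B p) by apply: bigsetU_measurable.
have mB : measurable (\bigcup_p B p) by exact: bigcupT_measurable.
have muUB : (mu (\bigcup_p B p) <= (4^-1)%:E)%E.
  apply: (le_trans (generalized_Boole_inequality mu mBp mB)).
  have -> : (4^-1)%:E = (\sum_(0 <= p <oo) (1 / (2 ^ (p + 3))%:R)%:E)%E :> \bar R.
    rewrite (cvg_lim (@ereal_hausdorff R) (@cvg_geometric_eseries_half R 1 2)).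
    by congr EFin; rewrite expr2; field.
  by apply: lee_nneseries => p *; [exact: measure_ge0|exact: muB].
have half0 : ~ ((2^-1)%:E <= 0 :> \bar R)%E by rewrite lee_fin; lra.
have muD : mu D = (2^-1)%:E.
  by rewrite lebesgue_measure_itv/= lte_fin oppr_lt0 invr_gt0 ltr0n -EFinB sub0r opprK.
have muC : mu C = (2^-1)%:E.
  rewrite lebesgue_measure_itv/= lte_fin invf_lt1// ltr1n -EFinB; congr EFin; lra.
have mf : lebesgue_measurable_fun (\1_J : R -> R).
  move=> _ Y mY; rewrite setTI; apply: sub_caratheodory.
  have mi : measurable_fun setT (\1_J : R -> R) by exact: measurable_indic.
  by have := mi measurableT Y mY; rewrite setTI.
move=> /(_ (\1_J)) [//|//|D0|C0]; apply: half0.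
  by rewrite -muD -D0; exact: le_outer_measure.
have : (mu C <= (4^-1)%:E)%E.
  rewrite -[leRHS]add0e -C0.
  have sub : C `<=` conv_set (\1_J) (mesh m) `|` \bigcup_p B p.
    by move=> x Cx; have [Bx|nBx] := pselect ((\bigcup_p B p) x); [right|left; exact: convC].
  apply: (le_trans (le_outer_measure ((wlength (@idfun R))^*)%mu _ _ sub)).
  apply: (le_trans (outer_measureU2 _ _ _)).
  by apply: leeD => //; exact: muUB.
by rewrite muC !lee_fin; lra.
Qed.
End large_jumps.

(** * The chain *)

Section chain.

(** The argument k.+1 keeps the values positive, so that both cases differ by
a factor less than 2 for every k. *)
Definition growth (n : int) (k : nat) : nat :=
  if (2 %| n)%Z then (2 ^ trunc_log 2 k.+1)%N else k.+1.

(** The integer part of 2^-n times [growth n k]. *)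
Definition resolution (n : int) (k : nat) : nat :=
  match n with
  | Posz i => (growth n k %/ 2 ^ i)%N
  | Negz i => (growth n k * 2 ^ i.+1)%N
  end.

Lemma growth_le n n' k : (growth n k <= 2 * growth n' k)%N.
Proof.
have h1 : (2 ^ trunc_log 2 k.+1 <= k.+1)%N by apply: trunc_logP.
have h2 : (k.+1 < 2 * 2 ^ trunc_log 2 k.+1)%N by rewrite -expnS; apply: trunc_log_ltn.
by rewrite /growth; case: ifP => _; case: ifP => _; lia.
Qed.

Lemma resolution_anti n k : (resolution (n + 1) k <= resolution n k)%N.
Proof.
have := growth_le (n + 1) n k.
case: n => [i|[|i]].
- rewrite -PoszD addn1 /resolution => h.
  rewrite expnS divnMA leq_div2r//.
  by rewrite -(@mulKn (growth i k) 2)// leq_div2r.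
- by rewrite /resolution /= => h; rewrite divn1 mulnC.
have -> : Negz i.+1 + 1 = Negz i by rewrite !NegzE; lia.
by rewrite /resolution => h; rewrite [(2 ^ i.+2)%N]expnS mulnA leq_mul2r; lia.
Qed.

Context {R : realType}.

Lemma mesh_sub m m' : (forall k, (m k <= m' k)%N) -> mesh m `<=` (mesh m' : set R).
Proof.
move=> mm' _ [k [i [ik ->]]]; exists k, (i * 2 ^ (m' k - m k))%N; split.
  by rewrite -(subnKC (mm' k)) expnD addKn ltn_pmul2r ?expn_gt0.
rewrite /mesh_point -[in RHS](subnKC (mm' k)) addKn exprD natrM natrX.
by congr (_ + _); rewrite invfM mulrACA divff ?mulr1// expf_neq0.
Qed.

Lemma resolution_type1 n : ~~ (2 %| n)%Z -> type1 (mesh (resolution n) : set R).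
Proof.
move=> odd_n.
have gE k : growth n k = k.+1 by rewrite /growth (negbTE odd_n).
case: n odd_n gE => i odd_n gE.
  apply: (@mesh_type1 R _ 1) => [k|l]; rewrite /resolution.
    rewrite !gE leq_div2r//=.
    apply: (@leq_trans ((k.+1 + 2 ^ i) %/ 2 ^ i)).
      by rewrite leq_div2r// -[k.+2]addn1 leq_add2l expn_gt0.
    by rewrite divnDr ?dvdnn// divnn expn_gt0.
  by exists (l * 2 ^ i)%N; rewrite gE leq_divRL ?expn_gt0.
apply: (@mesh_type1 R _ (2 ^ i.+1)) => [k|l]; rewrite /resolution.
  by rewrite !gE [(k.+2 * _)%N]mulSn addnC leq_addr leqnn.
by exists l; rewrite gE; apply: (leq_trans (leqnSn l)); rewrite leq_pmulr// expn_gt0.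
Qed.

Lemma resolution_type2 n : (2 %| n)%Z -> type2 (mesh (resolution n) : set R).
Proof.
move=> even_n.
have gE k : growth n k = (2 ^ trunc_log 2 k.+1)%N by rewrite /growth even_n.
have pow_gt t : (t < 2 ^ t)%N by exact: ltn_expl.
(* growth n doubles from the block K p to the next, where k.+1 reaches the
   power 2 ^ (e p).+1; e p absorbs the division by 2 ^ n when n > 0 *)
pose e p := (`|n|%N + p + 4)%N.
pose K p := (2 ^ (e p).+1 - 2)%N.
have KS p : (K p).+2 = (2 ^ (e p).+1)%N.
  by rewrite /K -addn2 subnK// expnS leq_pmulr// expn_gt0.
have g1 p : growth n (K p).+1 = (2 ^ (e p).+1)%N.
  by rewrite gE KS trunc_expnK.
have g0 p : growth n (K p) = (2 ^ (e p))%N.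
  rewrite gE; congr (2 ^ _)%N; apply: trunc_log_eq => //.
  have := KS p; rewrite expnS; have := pow_gt (e p); lia.
apply: (@mesh_type2 R _ K) => [p p' /(congr1 (fun k => k.+2))|p].
  by rewrite !KS => /eqP; rewrite eqn_exp2l// => /eqP; rewrite /e; lia.
move: g0 g1; rewrite /e; case: (n) => i g0 g1; rewrite /resolution g0 g1.
- rewrite absz_nat -(addnA i) expnD mulKn ?expn_gt0// -addnS (expnD 2 i) mulKn ?expn_gt0//.
  by have := pow_gt (p + 4)%N; rewrite [(2 ^ (p + 4).+1)%N]expnS; lia.
have : (p + 3 <= 2 ^ (`|Negz i|%N + p + 4) * 2 ^ i.+1)%N.
  apply: (@leq_trans (2 ^ (`|Negz i|%N + p + 4))); last by rewrite leq_pmulr// expn_gt0.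
  by apply: leq_trans (ltnW (pow_gt _)); lia.
by rewrite [(2 ^ (_ + 4).+1)%N]expnS -mulnA; lia.
Qed.

End chain.

Theorem theorem2p4 (R : realType) :
  exists Lam : int -> set R,
    [/\ forall n : int, admissible (Lam n),
        forall n : int, Lam (n + 1) `<=` Lam n,
        forall n : int, ~~ (2 %| n)%Z -> type1 (Lam n)
      & forall n : int, (2 %| n)%Z -> type2 (Lam n)].
Proof.
exists (fun n => mesh (resolution n)); split => n.
- exact: mesh_admissible.
- apply: mesh_sub => k; exact: resolution_anti.
- exact: resolution_type1.
- exact: resolution_type2.
Qed.
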